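(* Let $s\mathcal{SZ}(\mathbb{R})$ denote the set of all strong Sierpiński-Zygmund functions, i.e. functions $f:\mathbb{R}\to\mathbb{R}$ such that for every set $A\subseteq\mathbb{R}$ of cardinality $\omega_1$ the restriction $f|_A$ is not a Borel map. If $s\mathcal{SZ}(\mathbb{R})\neq\emptyset$, then $s\mathcal{SZ}(\mathbb{R})$ is strongly $\mathfrak{c}$-algebrable (as a subset of the algebra $\mathbb{R}^{\mathbb{R}}$).
   Context: Work in ZFC; $\mathfrak{c}=2^{\omega}$ is the cardinality of the continuum. $\mathbb{R}^{\mathbb{R}}$ is the real commutative algebra of all functions $\mathbb{R}\to\mathbb{R}$ with pointwise operations. A subset $S$ of a commutative real algebra $\mathcal{L}$ is strongly $\kappa$-algebrable if $S\cup\{0\}$ contains a $\kappa$-generated algebra isomorphic to a free (commutative, non-unital) algebra; equivalently, there is a set $X\subseteq\mathcal{L}$ of cardinality $\kappa$ such that for every $k\ge 1$, every nonzero real polynomial $P$ in $k$ variables without constant term and all distinct $y_1,\dots,y_k\in X$, we have $P(y_1,\dots,y_k)\neq 0$ and $P(y_1,\dots,y_k)\in S$. A map $f|_A:A\to\mathbb{R}$ is Borel if preimages of open sets are Borel in the subspace topology of $A$. *)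

(* Defs.v *)
From HB Require Import structures.
From mathcomp Require Import all_boot all_order all_algebra.
From mathcomp Require Import all_classical all_reals all_analysis.
From mathcomp Require wochoice mpoly.
Import (canonicals, coercions) mpoly.
Set Implicit Arguments.
Unset Strict Implicit.
Unset Printing Implicit Defensive.
Import Order.TTheory GRing.Theory Num.Theory.
Import numFieldNormedType.Exports.
Local Open Scope classical_set_scope.
Local Open Scope ring_scope.

(* MathComp-Analysis makes [T -> R] a commutative ring and an [R]-module under
   the pointwise operations, but does not join the two into an algebra. *)
Section function_algebra.
Variables (T : pointedType) (R : comNzRingType).

Let fct_scalerAl (a : R) (f g : T -> R^o) : a *: (f * g) = (a *: f) * g.
Proof. by apply/funext => x; exact: scalerAl. Qed.

HB.instance Definition _ :=
  GRing.Lmodule_isLalgebra.Build R (T -> R^o) fct_scalerAl.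

Let fct_scalerAr (a : R) (f g : T -> R^o) : a *: (f * g) = f * (a *: g).
Proof. by apply/funext => x; exact: scalerAr. Qed.

HB.instance Definition _ :=
  GRing.Lalgebra_isAlgebra.Build R (T -> R^o) fct_scalerAr.

End function_algebra.

Definition poly_eval (R : comNzRingType) (L : comAlgType R) (k : nat)
    (y : 'I_k -> L) (P : mpoly.mpoly k R) : L :=
  mpoly.mmap (fun c : R => c%:A) y P.

(* The cardinal kappa is the cardinality of [K]. [X] is a set of free generators
   of a non-unital commutative algebra, hence the vanishing constant term. *)
Definition strongly_algebrable (R : realType) (L : comAlgType R)
    (U : Type) (K : set U) (S : set L) : Prop :=
  exists X : set L, (X #= K)%card /\
    forall (k : nat) (P : mpoly.mpoly k R) (y : 'I_k -> L),
      (0 < k)%N -> P != 0 -> mpoly.mcoeff mpoly.mnm0 P = 0 ->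
      injective y -> (forall i, X (y i)) ->
      poly_eval y P != 0 /\ S (poly_eval y P).

(* omega_1 is the least uncountable ordinal: uncountable, with every smaller
   ordinal (i.e. proper initial segment) countable. [wochoice.well_order] already
   entails that [le] is a total order. *)
Definition is_omega1 (W : eqType) (le : rel W) : Prop :=
  [/\ wochoice.well_order le,
      ~ countable [set: W] &
      forall w : W, countable [set v | le v w && (v != w)]].

Definition card_omega1 (T : Type) (A : set T) : Prop :=
  exists (W : eqType) (le : rel W), is_omega1 le /\ (A #= [set: W])%card.

Definition borel_sets (T : topologicalType) : set (set T) :=
  <<s [set V : set T | open V] >>.

Definition borel_map (S T : topologicalType) (f : S -> T) : Prop :=
  forall V : set T, open V -> borel_sets (f @^-1` V).

(* The topology of [set_type A] is the subspace topology of [A], and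
   [sigL A f : set_type A -> R] is the restriction of [f] to [A]. *)
Definition strong_SZ (R : realType) : set (R -> R) :=
  [set f | forall A : set R, card_omega1 A -> ~ borel_map (sigL A f)].
Arguments strong_SZ : clear implicits.

(* Main.v *)
Require Import Defs.
From mathcomp Require Import all_boot all_order all_algebra.
From mathcomp Require Import all_classical all_reals all_analysis.
From mathcomp Require Import measurable_realfun ring zify.
From mathcomp Require mpoly.
Import (canonicals, coercions) mpoly.
Import Order.TTheory GRing.Theory Num.Theory.
Import numFieldNormedType.Exports.
Local Open Scope classical_set_scope.
Local Open Scope ring_scope.

(** Let f be a strong Sierpinski-Zygmund function. The free generators are the
    functions exp (r * f), where r runs over a family of continuum many reals
    that is linearly independent over the integers. A polynomial P without
    constant term, evaluated at distinct generators, is Q o f, where Q is an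
    exponential sum: each monomial of P contributes one term c * exp (b t).
    Independence makes the exponents b of distinct monomials distinct, and
    nonzero because the constant monomial is absent.

    A nonzero exponential sum has only countably many zeros
    ([countable_expsum_zeros]). Applied to the derivative of Q, this covers the
    line by countably many sets on each of which Q is strictly monotone
    ([countable_monotone_cover]). If Q o f were Borel on a set A of cardinality
    omega_1, then f would map uncountably many points of A into a single one of
    these sets; there Q can be inverted, so f is Borel on an uncountable subset
    of A, which again has cardinality omega_1. This contradicts the choice of f
    ([strong_SZ_comp_countable_monotone]).

    The evaluated polynomial is not the zero function because no constant
    function is strong Sierpinski-Zygmund: the line does have subsets of
    cardinality omega_1 ([exists_card_omega1]).

    The reals r are r_a = sum of 1 / e! over the codes e of the finite prefixes
    of a binary sequence a. Distinct sequences share only finitely many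
    prefixes, and a series of d_e / e! with bounded integers d_e can vanish
    only if d_e does eventually ([eventually_zero_of_factorial_series]);
    together these give the independence ([prefix_real_free]). *)

(** * Sets of cardinality omega_1 *)

Lemma well_order_antisymmetric {T : eqType} {le : rel T} :
  wochoice.well_order le -> antisymmetric le.
Proof.
move=> wo x y; apply: (@wochoice.wo_chain_antisymmetric _ le predT) => // A _.
exact: wo.
Qed.

Lemma card_omega1_eq {T U : Type} {A : set T} {B : set U} :
  (A #= B)%card -> card_omega1 B -> card_omega1 A.
Proof.
by move=> AB [W [le [ole BW]]]; exists W, le; split => //; exact: card_eq_trans BW.
Qed.

Lemma well_order_relpre {T U : eqType} (h : T -> U) {le : rel U} :
  injective h -> wochoice.well_order le -> wochoice.well_order (relpre h le).
Proof.
move=> inj_h wo; apply: wochoice.antisymmetric_well_order.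
  move=> x y /(well_order_antisymmetric wo); exact: inj_h.
move=> A [a Aa].
have [|z [[/asboolP[x Ax <-] lbz] _]] :=
  wo [pred v | `[< exists2 x, x \in A & h x = v >]].
  by exists (h a); apply/asboolP; exists a.
by exists x; split=> // y Ay; apply: lbz; apply/asboolP; exists y.
Qed.

(** No comparison of order types is involved: the restriction of the well-order
    to B is itself a witness that B has cardinality omega_1. *)
Lemma card_omega1_subset {W : eqType} {le : rel W} {B : set W} :
  wochoice.well_order le -> ~ countable B ->
  (forall b, B b -> countable (B `&` [set v | le v b && (v != b)])) ->
  card_omega1 B.
Proof.
move=> wo ncB segB; apply: (card_omega1_eq (card_setT_sym B)).
pose leB : rel B := relpre val le.
exists (set_type B), leB; split; last exact: card_eqxx.
split; first exact: (well_order_relpre _ val_inj).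
- by rewrite (eq_countable (card_setT _)).
- move=> b; rewrite -(eq_countable (inj_card_eq (f := val) _)); last first.
    by move=> x y _ _; exact: val_inj.
  apply: sub_countable (segB (val b) (set_valP b)); apply: subset_card_le.
  by move=> _ [x /= xb <-]; split; [exact: set_valP|rewrite (inj_eq val_inj)].
Qed.

Lemma card_omega1_sub {T : Type} {A A' : set T} :
  A' `<=` A -> ~ countable A' -> card_omega1 A -> card_omega1 A'.
Proof.
move=> A'A ncA' [W [le [[wo _ seg] /card_bijP[g /bij_inj gi]]]].
pose h (x : A) := val (g x).
have inj_h : injective h.
  by move=> x y /val_inj /gi.
pose v (x : A) : T := val x.
pose D : set A := v @^-1` A'.
have DA' : (h @` D #= A')%card.
  have hD : (h @` D #= D)%card by apply: inj_card_eq => x y _ _; exact: inj_h.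
  have vD : (v @` D #= D)%card.
    apply: inj_card_eq => x y _ _; exact: val_inj.
  rewrite (_ : v @` D = A') in vD; first exact: card_eq_trans (card_esym vD).
  rewrite eqEsubset; split=> [_ [x /= Dx <-] //|x A'x].
  by exists (SigSub (mem_set (A'A _ A'x))).
apply: card_omega1_eq (card_esym DA') _.
apply: card_omega1_subset wo _ _; first by rewrite (eq_countable DA').
move=> b _; apply: sub_countable (seg b).
by apply: subset_card_le; exact: subIsetr.
Qed.

(** Well-order T. Either every proper initial segment is countable, and T itself
    will do, or the least uncountable initial segment will. *)
Lemma exists_card_omega1 {T : choiceType} :
  ~ countable [set: T] -> exists A : set T, card_omega1 A.
Proof.
move=> ncT; have [le wo] := wochoice.well_ordering_principle T.
pose seg (w : T) := [set v | le v w && (v != w)].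
have [allc|] := pselect (forall w, countable (seg w)).
  exists setT; apply: (card_omega1_subset wo ncT) => b _; rewrite setTI; exact: allc.
move=> /existsNP[w0 ncw0].
have [|w [[/asboolP ncw lbw] _]] := wo [pred w | `[< ~ countable (seg w) >]].
  by exists w0; apply/asboolP.
exists (seg w); apply: (card_omega1_subset wo ncw) => b /andP[lebw neqbw].
apply: contrapT => ncb.
have ncsb : ~ countable (seg b).
  move=> cb; apply: ncb; apply: sub_countable cb.
  by apply: subset_card_le; exact: subIsetr.
have /lbw lewb : b \in [pred w | `[< ~ countable (seg w) >]] by exact/asboolP.
have /(well_order_antisymmetric wo) bw : le b w && le w b by apply/andP.
by rewrite bw eqxx in neqbw.
Qed.

(** * Borel maps and composition with piecewise monotone functions *)

(** The sets with Borel preimage form a sigma-algebra, so a map is seen to be Borel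
    on any family generating the sigma-algebra of the target. *)
Lemma sub_borel_preimage {S T : topologicalType} {f : S -> T} {G : set (set T)} :
  (forall V, G V -> borel_sets (f @^-1` V)) ->
  <<s G >> `<=` [set V | borel_sets (f @^-1` V)].
Proof.
have [b0 bC bU] := smallest_sigma_algebra setT [set V : set S | open V].
move=> GV; apply: smallest_sub GV; split; rewrite /mkset.
- exact: b0.
- by move=> V /bC; rewrite !setTD preimage_setC.
- by move=> V bV; rewrite preimage_bigcup; exact: bU.
Qed.

Lemma continuous_borel_map {S T : topologicalType} {f : S -> T} :
  continuous f -> borel_map f.
Proof. by move=> /continuousP cf V oV; apply: sub_sigma_algebra; exact: cf. Qed.

Lemma borel_map_comp {S T U : topologicalType} {f : S -> T} {g : T -> U} :
  borel_map f -> borel_map g -> borel_map (g \o f).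
Proof.
by move=> bf bg V /bg; exact: (sub_borel_preimage bf).
Qed.

Lemma borel_map_interval {R : realType} {S : topologicalType} {h : S -> R} {V : set R} :
  borel_map h -> is_interval V -> borel_sets (h @^-1` V).
Proof.
move=> bh /is_interval_measurable; rewrite [measurable]RGenOpens.measurableE.
apply: sub_borel_preimage => _ [x [y ->]].
by apply: bh; exact: interval_open.
Qed.

Lemma borel_map_rays {R : realType} {S : topologicalType} {f : S -> R} :
  (forall a, borel_sets [set x | a < f x]) -> borel_map f.
Proof.
move=> rf V /open_measurable; rewrite [measurable]RGenOInfty.measurableE.
apply: sub_borel_preimage => _ [a ->].
rewrite [X in borel_sets X](_ : _ = [set x | a < f x]) //.
by apply/seteqP; split=> x /=; rewrite in_itv /= andbT.
Qed.

Definition strictly_monotone {R : realType} (I : set R) (Q : R -> R) : Prop :=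
  {in I &, {mono Q : x y / x <= y}} \/ {in I &, {mono Q : x y /~ x <= y}}.

Lemma strictly_monotone_inj {R : realType} {I : set R} {Q : R -> R} :
  strictly_monotone I Q -> {in I &, injective Q}.
Proof.
by case=> mQ; [exact: inc_inj_in|exact: dec_inj_in].
Qed.

(** For Q increasing on I and values of f in I, f x > a holds exactly when Q (f x)
    dominates some Q t with t > a in I. This is membership of Q (f x) in an
    upward closed set, hence in an interval; so I may be arbitrary, and Q may be
    discontinuous. The decreasing case is symmetric. *)
Lemma borel_map_cancel_monotone {R : realType} {S : topologicalType}
    {I : set R} {Q : R -> R} {f : S -> R} :
  strictly_monotone I Q -> (forall x, I (f x)) ->
  borel_map (Q \o f) -> borel_map f.
Proof.
move=> mQ fI bQf; apply: borel_map_rays => a.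
case: mQ => mQ.
- pose U := [set y | exists t, [/\ I t, a < t & Q t <= y]].
  rewrite (_ : [set x | _] = (Q \o f) @^-1` U).
    apply: borel_map_interval bQf _ => x y [t [It at_ tx]] _ z /andP[xz _].
    by exists t; split=> //; exact: le_trans xz.
  apply/seteqP; split=> x /= => [axf|[t [It at_]]]; first by exists (f x).
  by rewrite mQ ?inE//; exact: lt_le_trans.
- pose U := [set y | exists t, [/\ I t, a < t & y <= Q t]].
  rewrite (_ : [set x | _] = (Q \o f) @^-1` U).
    apply: borel_map_interval bQf _ => x y _ [t [It at_ ty]] z /andP[_ zy].
    by exists t; split=> //; exact: le_trans ty.
  apply/seteqP; split=> x /= => [axf|[t [It at_]]]; first by exists (f x).
  by rewrite mQ ?inE//; exact: lt_le_trans.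
Qed.

Definition sub_incl {T : Type} {A' A : set T} (A'A : A' `<=` A) (x : A') : A :=
  SigSub (mem_set (A'A _ (set_valP x))).

Lemma borel_map_sigL_sub {S T : topologicalType} {A' A : set S} {f : S -> T} :
  A' `<=` A -> borel_map (sigL A f) -> borel_map (sigL A' f).
Proof.
move=> A'A bf.
have cj : continuous (sub_incl A'A).
  apply: continuous_comp_initial.
  rewrite (_ : _ \o _ = set_val); first exact: initial_continuous.
  by apply/funext => x /=; rewrite !set_valE.
have := borel_map_comp (continuous_borel_map cj) bf.
by congr borel_map; apply/funext => x; rewrite /sigL /= !set_valE.
Qed.

(** One of the countably many pieces has an uncountable preimage under f in A. On
    that preimage f can be recovered from [Q \o f] in a Borel way. *)
Lemma strong_SZ_comp_countable_monotone {R : realType} {f Q : R -> R} {C : set (set R)} :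
  countable C -> (forall t, exists2 I, C I & I t) ->
  (forall I, C I -> strictly_monotone I Q) ->
  strong_SZ R f -> strong_SZ R (Q \o f).
Proof.
move=> cC covC mC szf A oA bQf.
pose piece (I : set R) := A `&` f @^-1` I.
have [I CI ncI] : exists2 I, C I & ~ countable (piece I).
  apply: contrapT => noI; case: (oA) => W [le [[_ ncW _] /eq_countable AW]].
  apply: ncW; rewrite -AW.
  apply: sub_countable (_ : countable (\bigcup_(I in C) piece I)).
    apply: subset_card_le => x Ax; have [I CI Ifx] := covC (f x).
    by exists I.
  by apply: bigcup_countable => // I CI; apply: contrapT => ncI; apply: noI; exists I.
have pA : piece I `<=` A by exact: subIsetl.
apply: (szf _ (card_omega1_sub pA ncI oA)).
apply: (borel_map_cancel_monotone (mC _ CI)).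
  by move=> x; have [_] := set_valP x.
exact: (borel_map_sigL_sub pA bQf).
Qed.

Lemma uncountable_real {R : realType} : ~ countable [set: R].
Proof.
by move=> /countable_lebesgue_measure0; rewrite -set_itvNyy lebesgue_measure_itv.
Qed.

(** Every function would be strong Sierpinski-Zygmund if the line had no subset of
    cardinality omega_1, so the existence of such a subset is essential here. *)
Lemma strong_SZ_neq_cst {R : realType} (f : R -> R) (c : R) :
  strong_SZ R f -> f <> cst c.
Proof.
have [A oA] := exists_card_omega1 (@uncountable_real R).
move=> /(_ _ oA) + fc; apply; apply: continuous_borel_map.
by rewrite fc => x; exact: cst_continuous.
Qed.

(** * Exponential sums *)

Lemma strictly_monotone_derive {R : realType} {F dF : R -> R} {a b : R} :
  (forall t : R, is_derive t 1 F (dF t)) ->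
  (forall t : R, t \in `]a, b[ -> 0 < dF t) \/
    (forall t : R, t \in `]a, b[ -> dF t < 0) ->
  strictly_monotone `]a, b[ F.
Proof.
move=> FdF sdF.
have FB (x y : R) : x \in `]a, b[ -> y \in `]a, b[ -> x < y ->
    exists2 c, c \in `]a, b[ & F y - F x = dF c * (y - x).
  move=> xab yab xy.
  have [|c cxy ->] := MVT xy (fun t _ => FdF t).
    apply: derivable_within_continuous => t _; exact: ex_derive.
  exists c => //; rewrite in_itv /=.
  move: xab yab cxy; rewrite !in_itv /= => /andP[ax _] /andP[_ yb] /andP[xc cy].
  by rewrite (lt_trans ax xc) (lt_trans cy yb).
case: sdF => sdF; [left|right].
  apply: le_mono_in => x y; rewrite !inE => xab yab xy.
  have [c cab FE] := FB x y xab yab xy.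
  by rewrite -subr_gt0 FE mulr_gt0 ?subr_gt0 ?sdF.
apply: le_nmono_in => y x; rewrite !inE => yab xab xy.
have [c cab FE] := FB _ _ xab yab xy.
by rewrite -subr_lt0 FE nmulr_rlt0 ?subr_gt0 ?sdF.
Qed.

(** A zero of the derivative forms a piece of its own. Around any other point the
    derivative keeps its sign on an interval, which can be shrunk to one with
    rational endpoints, and there are countably many of these. *)
Lemma countable_monotone_cover {R : realType} {F dF : R -> R} :
  (forall t : R, is_derive t 1 F (dF t)) -> continuous dF ->
  countable [set t | dF t = 0] ->
  exists C : set (set R), [/\ countable C, forall t, exists2 I, C I & I t &
    forall I, C I -> strictly_monotone I F].
Proof.
move=> FdF cdF cZ.
pose J (pq : rat * rat) : set R := `]ratr pq.1, ratr pq.2[%classic.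
exists ([set [set z] | z in [set t | dF t = 0]] `|`
        [set J pq | pq in [set pq | strictly_monotone (J pq) F]]).
split.
- rewrite -bigcup2E; apply: bigcup_countable => // -[|[|i]] _ //=.
    exact: sub_countable (card_image_le _ _) cZ.
  exact: sub_countable (card_image_le _ _) _.
- move=> t; have [tZ|/eqP tZ] := eqVneq (dF t) 0.
    by exists [set t] => //; left; exists t.
  suff [e e0 sdF] : exists2 e, 0 < e &
      (forall u, u \in `]t - e, t + e[ -> 0 < dF u) \/
      (forall u, u \in `]t - e, t + e[ -> dF u < 0).
    have /rat_in_itvoo[p pt] : t - e < t by rewrite ltrBlDr ltrDl.
    have /rat_in_itvoo[q tq] : t < t + e by rewrite ltrDl.
    move: pt tq; rewrite !in_itv /= => /andP[ep pt] /andP[tq qe].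
    exists (J (p, q)); last by rewrite /J /= in_itv /= pt tq.
    right; exists (p, q) => //; apply: (strictly_monotone_derive FdF).
    have sub u : u \in `](ratr p : R), ratr q[ -> u \in `]t - e, t + e[.
      rewrite !in_itv /= => /andP[pu uq].
      by rewrite (lt_trans ep pu) (lt_trans uq qe).
    by case: sdF => sdF; [left|right] => u /sub; exact: sdF.
  have itv_ball e u : u \in `]t - e, t + e[ -> ball t e u.
    by rewrite in_itv /= /ball /= distrC ltr_distl.
  have [dt|dt|//] := ltgtP (dF t) 0.
    have /nbhs_ballP[e /= e0 eP] : \forall u \near t, dF u < 0.
      exact: cvgr_lt (cdF t) _ dt.
    by exists e => //; right => u /itv_ball /eP.
  have /nbhs_ballP[e /= e0 eP] : \forall u \near t, 0 < dF u.
    exact: cvgr_gt (cdF t) _ dt.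
  by exists e => //; left => u /itv_ball /eP.
- move=> I [[z _ <-]|[pq mJ <-] //].
  by left => x y; rewrite !inE => -> ->; rewrite !lexx.
Qed.

(** Each piece of the cover meets a fiber in at most one point. *)
Lemma countable_fiber {R : realType} {F : R -> R} {C : set (set R)} (y : R) :
  countable C -> (forall t, exists2 I, C I & I t) ->
  (forall I, C I -> strictly_monotone I F) ->
  countable [set t | F t = y].
Proof.
move=> cC covC mC.
apply: sub_countable (_ : countable (\bigcup_(I in C) (I `&` [set t | F t = y]))).
  by apply: subset_card_le => t Ft; have [I CI It] := covC t; exists I.
apply: bigcup_countable => // I /mC /strictly_monotone_inj injF.
apply/countable_injP; exists (fun=> 0%N) => u v; rewrite !inE.
by move=> [Iu Fu] [Iv Fv] _; apply: injF; rewrite ?inE// Fu Fv.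
Qed.

(** The pairs are (coefficient, exponent). *)
Definition expsum {R : realType} (s : seq (R * R)) (t : R) : R :=
  \sum_(p <- s) p.1 * expR (p.2 * t).

Definition expsum_deriv {R : realType} (s : seq (R * R)) : seq (R * R) :=
  [seq (p.1 * p.2, p.2) | p <- s].

Lemma is_derive_expsum {R : realType} (s : seq (R * R)) (t : R) :
  is_derive t 1 (expsum s) (expsum (expsum_deriv s) t).
Proof.
rewrite /expsum big_map.
elim: s => [|p s IHs].
  rewrite big_nil; under eq_fun do rewrite big_nil; exact: is_derive_cst.
rewrite big_cons; under eq_fun do rewrite big_cons.
have pP : is_derive t 1 (fun u => p.1 * expR (p.2 * u)) (p.1 * p.2 * expR (p.2 * t)).
  rewrite -mulrA; apply: (@is_deriveZ _ _ _ (fun u => expR (p.2 * u)) p.1).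
  rewrite mulrC; apply: (@is_derive1_comp _ expR (fun u => p.2 * u)).
  by apply: is_derive_eq; rewrite [LHS]mulr1.
exact: is_deriveD.
Qed.

Lemma continuous_expsum {R : realType} (s : seq (R * R)) : continuous (expsum s).
Proof.
move=> t; apply: differentiable_continuous; apply/derivable1_diffP.
exact: (@ex_derive _ _ _ _ _ _ _ (is_derive_expsum s t)).
Qed.

(** Induction on the number of terms, in the manner of Rolle: dividing by
    exp (b t), where (c, b) is the first term, turns the zeros into the fiber over
    - c of a shorter sum u. The derivative of u has as many terms as u, and its
    coefficients do not vanish since the exponents were distinct; hence u is
    strictly monotone on countably many pieces covering the line. *)
Lemma countable_expsum_zeros {R : realType} (s : seq (R * R)) :
  s != [::] -> uniq (map snd s) -> all (fun p => p.1 != 0) s ->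
  countable [set t | expsum s t = 0].
Proof.
move En: (size s) => n; elim: n s En => [[]//|n IHn] [//|[c b] s] /= [sn] _.
move=> /andP[bs us] /andP[c0 sc].
pose u := [seq (p.1, p.2 - b) | p <- s].
have zE : [set t | expsum ((c, b) :: s) t = 0] = [set t | expsum u t = - c].
  have E t : expsum ((c, b) :: s) t = expR (b * t) * (expsum u t + c).
    rewrite /expsum big_cons big_map mulrDr mulr_sumr addrC mulrC; congr (_ + _).
    apply: eq_bigr => p _ /=; rewrite mulrCA -expRD; congr (_ * expR _).
    by rewrite mulrBl addrC subrK.
  apply/seteqP; split=> t /=; rewrite E.
    by move/eqP; rewrite mulf_eq0 gt_eqF ?expR_gt0//= addr_eq0 => /eqP.
  by move=> ->; rewrite addNr mulr0.
rewrite {}zE; have [s0|s0] := eqVneq s [::].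
  rewrite (_ : [set t | _] = set0)//; apply/seteqP; split=> t //=.
  rewrite /u s0 /expsum big_nil => /eqP; rewrite eq_sym oppr_eq0.
  by rewrite (negbTE c0).
have : countable [set t | expsum (expsum_deriv u) t = 0].
  apply: IHn.
  - by rewrite !size_map.
  - by rewrite -size_eq0 !size_map size_eq0.
  - have -> : map snd (expsum_deriv u) = [seq x - b | x <- map snd s].
      by rewrite -!map_comp; apply: eq_map.
    by rewrite map_inj_uniq//; exact: addIr.
  - rewrite !all_map; apply/allP => p ps /=.
    rewrite mulf_neq0 ?(allP sc)// subr_eq0; apply: contra bs => /eqP <-.
    exact: map_f.
move=> /(countable_monotone_cover (is_derive_expsum u) (continuous_expsum _)).
by move=> [C [cC covC mC]]; exact: countable_fiber mC.
Qed.

(** * An independent family of reals indexed by binary sequences *)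

(** The argument for the irrationality of e. Multiplying the n-th partial sum by
    n! gives an integer, whereas the vanishing of the whole series bounds that
    integer by n! times the tail, which is at most 2 M / (n + 1). So the partial
    sums vanish from some point on, and with them their differences. *)
Lemma eventually_zero_of_factorial_series {R : realType} (d : nat -> int) (M : R) :
  (forall e, `|(d e)%:~R| <= M) ->
  (fun n => \sum_(0 <= e < n) (d e)%:~R / e`!%:R : R) @ \oo --> (0 : R) ->
  exists N, forall e, (N <= e)%N -> d e = 0.
Proof.
move=> dM; set s := (X in X @ _ --> _) => s0.
have sS n : s n.+1 = s n + (d n)%:~R / n`!%:R by rewrite /s big_nat_recr.
have fn0 n : n`!%:R != 0 :> R by rewrite pnatr_eq0 -lt0n fact_gt0.
have n1_neq0 n : n%:R + 1 != 0 :> R by rewrite natr1 pnatr_eq0.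
have fn_gt0 n : 0 < n`!%:R :> R by rewrite ltr0n fact_gt0.
have M0 : 0 <= M by exact: le_trans (dM 0%N).
(* The quantities 2 M / n! decrease by at least M / n! at each step, which bounds
   blocks of the series by telescoping. *)
have s_near n m : `|s (n.+1 + m)%N - s n.+1| <=
    2 * M / n.+1`!%:R - 2 * M / (n.+1 + m)`!%:R.
  elim: m => [|m IHm]; first by rewrite addn0 !subrr normr0.
  rewrite addnS sS addrAC; apply: le_trans (ler_normD _ _) _.
  rewrite [X in _ <= X](_ : _ = 2 * M / n.+1`!%:R - 2 * M / (n.+1 + m)`!%:R +
    (2 * M / (n.+1 + m)`!%:R - 2 * M / (n.+1 + m).+1`!%:R)); last by ring.
  apply: lerD IHm _; set k := (n.+1 + m)%N.
  rewrite normrM normfV (gtr0_norm (fn_gt0 k)).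
  have -> : 2 * M / k`!%:R - 2 * M / k.+1`!%:R = (2 * M * k%:R / k.+1%:R) / k`!%:R :> R.
    rewrite factS natrM -(natr1 k); field.
    by apply/andP; split=> //; exact: n1_neq0.
  rewrite ler_pM2r ?invr_gt0// ler_pdivlMr ?ltr0n//.
  apply: le_trans (_ : M * k.+1%:R <= _); first by rewrite ler_wpM2r.
  rewrite -mulrA mulrCA ler_wpM2l// -natrM ler_nat; rewrite /k; lia.
have s_small n : `|s n.+1| <= 2 * M / n.+1`!%:R.
  have sl : (fun m => `|s (m + n.+1)%N - s n.+1|) @ \oo --> `|0 - s n.+1|.
    apply: cvg_norm; apply: cvgB; last exact: cvg_cst.
    by rewrite (cvg_shiftn n.+1 s).
  rewrite -normrN -sub0r -(cvg_lim _ sl)//.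
  apply: limr_le; first by apply/cvg_ex; eexists; exact: sl.
  near=> m; rewrite addnC; apply: le_trans (s_near n m) _.
  by rewrite gerBl divr_ge0 ?mulr_ge0// ltW.
have s_int n : exists z : int, n`!%:R * s n.+1 = z%:~R.
  elim: n => [|n [z zE]].
    by exists (d 0%N); rewrite /s big_nat1 fact0 mul1r divr1.
  exists (n.+1%:Z * z + d n.+1); rewrite sS mulrDr [X in _ + X]mulrCA divff// mulr1.
  by rewrite factS natrM -mulrA zE rmorphD rmorphM.
pose N := (Num.truncn (2 * M)).+1.
have s_eq0 n : (N <= n)%N -> s n.+1 = 0.
  move=> Nn; have [z zE] := s_int n.
  have z1 : `|z%:~R| < 1 :> R.
    rewrite -zE normrM gtr0_norm//; apply: le_lt_trans (_ : 2 * M / n.+1%:R < 1).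
      apply: le_trans (ler_wpM2l (ltW (fn_gt0 n)) (s_small n)) _.
      rewrite factS natrM [X in X <= _](_ : _ = 2 * M / n.+1%:R)//.
      rewrite -(natr1 n); field.
      by apply/andP; split=> //; exact: n1_neq0.
    rewrite ltr_pdivrMr ?ltr0n// mul1r.
    apply: lt_le_trans (_ : N%:R <= _); first exact: truncnS_gt.
    by rewrite ler_nat; exact: leqW.
  have z0 : z = 0.
    move: z1; rewrite -intr_norm -[1]/(1%:~R) ltr_int; lia.
  by apply/eqP; move/eqP: zE; rewrite z0 mulf_eq0 (negbTE (fn0 n)).
exists N.+1 => -[//|e] Ne.
have := sS e.+1; rewrite !s_eq0//; last exact: leqW.
rewrite add0r => /esym/eqP; rewrite mulf_eq0 invr_eq0 (negbTE (fn0 _)) orbF.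
by rewrite intr_eq0 => /eqP.
Unshelve. all: by end_near.
Qed.

(** The number whose binary expansion is a leading 1 followed by the first n terms
    of a, the earliest being the most significant. The leading 1 makes the code
    determine n. *)
Fixpoint prefix_code (a : nat -> bool) (n : nat) : nat :=
  if n is m.+1 then (a m + (prefix_code a m).*2)%N else 1%N.

Lemma prefix_code_gt (a : nat -> bool) (n : nat) : (n < prefix_code a n)%N.
Proof. by elim: n => //= n; rewrite -addnn; case: (a n); lia. Qed.

Lemma prefix_code_inj (a b : nat -> bool) (n m : nat) :
  prefix_code a n = prefix_code b m ->
  n = m /\ forall i, (i < n)%N -> a i = b i.
Proof.
have gt1 c k : (1 < prefix_code c k.+1)%N.
  by have := prefix_code_gt c k; rewrite /= -addnn; lia.
elim: n m => [|n IHn] [|m] //.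
- by move=> e; have := gt1 b m; rewrite -e.
- by move=> e; have := gt1 a n; rewrite e.
move=> /= e; have anm : a n = b m.
  by move/(congr1 odd): e; rewrite !oddD !odd_double !addbF !oddb.
move: e; rewrite anm => /addnI /double_inj /IHn[nm ab]; split; first by rewrite nm.
move=> i; rewrite ltnS leq_eqVlt => /orP[/eqP -> |/ab//].
by rewrite anm nm.
Qed.

Definition coded (a : nat -> bool) (e : nat) : bool :=
  [exists n : 'I_e, prefix_code a n == e].

Lemma codedP (a : nat -> bool) (e : nat) :
  reflect (exists n, prefix_code a n = e) (coded a e).
Proof.
apply: (iffP existsP) => [[n /eqP]|[n ne]]; first by exists n.
have lt_ne : (n < e)%N by rewrite -ne prefix_code_gt.
by exists (Ordinal lt_ne); apply/eqP.
Qed.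

Definition prefix_real (R : realType) (a : nat -> bool) : R :=
  limn (fun n => \sum_(0 <= e < n) (coded a e)%:R / e`!%:R : R).

Lemma cvg_prefix_real (R : realType) (a : nat -> bool) :
  (fun n => \sum_(0 <= e < n) (coded a e)%:R / e`!%:R : R) @ \oo --> prefix_real R a.
Proof.
apply: (@series_le_cvg R (fun e => (coded a e)%:R / e`!%:R : R) (exp_coeff 1)).
- by move=> n; rewrite divr_ge0.
- by move=> n; exact: exp_coeff_ge0.
- move=> n; rewrite /exp_coeff /= expr1n ler_wpM2r//.
  by case: (coded a n).
- exact: is_cvg_series_exp_coeff.
Qed.

(** If q i0 is nonzero, look at the code e of a prefix of a i0 long enough to tell
    a i0 from all the other sequences: e codes a prefix of no other a i, so the
    coefficient of 1 / e! in the combination is q i0. This occurs for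
    arbitrarily large e. *)
Lemma prefix_real_free {R : realType} {k : nat} {a : 'I_k -> nat -> bool}
    {q : 'I_k -> int} :
  injective a -> \sum_i (q i)%:~R * prefix_real R (a i) = 0 ->
  forall i, q i = 0.
Proof.
move=> inj_a q0 i0; apply/eqP/negP => /negP qi0.
pose d e : int := \sum_i q i * (coded (a i) e)%:Z.
have [N dN] : exists N, forall e, (N <= e)%N -> d e = 0.
  apply: (@eventually_zero_of_factorial_series R d (\sum_i `|q i|%:~R)).
    move=> e; rewrite rmorph_sum /=; apply: le_trans (ler_norm_sum _ _ _) _.
    apply: ler_sum => i _; rewrite rmorphM /= normrM -intr_norm.
    by case: (coded _ _); rewrite ?normr1 ?mulr1// normr0 mulr0 ler0z.
  rewrite -[X in _ --> X]q0 (_ : (fun n => _) = fun n => \sum_i (q i)%:~R *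
      \sum_(0 <= e < n) (coded (a i) e)%:R / e`!%:R); last first.
    apply/funext => n; under [RHS]eq_bigr do rewrite mulr_sumr.
    rewrite exchange_big /=; apply: eq_bigr => e _.
    rewrite rmorph_sum /= mulr_suml; apply: eq_bigr => i _.
    by rewrite rmorphM /= mulrA.
  apply: cvg_big => [|i _]; first exact: add_continuous.
  by apply: cvgMl_tmp; exact: cvg_prefix_real.
have /choice[j jP] i : exists j, i != i0 -> a i j != a i0 j.
  have [->|ii0] := eqVneq i i0; first by exists 0%N; rewrite eqxx.
  apply: contrapT => /forallNP aj; move/eqP: ii0; apply; apply: inj_a.
  apply/funext => j; apply/eqP/negP => /negP neq; exact: (aj j).
(* The sum serves as an upper bound of N and of all the positions j i. *)
pose n := (N + \sum_i (j i).+1)%N.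
have jn i : (j i < n)%N.
  by rewrite /n (bigD1 i)//= addnCA addSn ltnS leq_addr.
move/eqP: qi0; apply.
rewrite -(dN (prefix_code (a i0) n)); last first.
  by apply: leq_trans (ltnW (prefix_code_gt _ _)); exact: leq_addr.
rewrite /d (bigD1 i0)//= big1 ?addr0.
  by rewrite (_ : coded _ _) ?mulr1//; apply/codedP; exists n.
move=> i ii0; rewrite (_ : coded _ _ = false) ?mulr0//; apply/codedP => -[m].
move=> /prefix_code_inj[-> /(_ (j i) (jn i)) aE].
by have := jP i ii0; rewrite aE eqxx.
Qed.

(** Independence of the two-element family that a and b form if they differ. *)
Lemma prefix_real_inj (R : realType) : injective (prefix_real R).
Proof.
move=> a b rab; apply: contrapT => neq_ab.
pose c (i : 'I_2) := if i == 0 then a else b.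
have inj_c : injective c.
  move=> i j; rewrite /c; case: (eqVneq i 0) => i0; case: (eqVneq j 0) => j0 //.
  - by rewrite i0 j0.
  - by move=> /esym.
  - by case: i i0 => [[|[|]]]//; case: j j0 => [[|[|]]]// *; exact: val_inj.
have := @prefix_real_free R 2 c (fun i => if i == 0 then 1 else -1) inj_c _ 0.
by rewrite !big_ord_recl big_ord0 /c /= rab mul1r mulN1r addr0 subrr => /(_ erefl).
Qed.

(** * Polynomials in exponentials *)

Lemma poly_eval_funE {R : realType} {k : nat} (y : 'I_k -> R -> R^o)
    (P : mpoly.mpoly k R) (x : R) :
  poly_eval (L := (R -> R^o)%type) y P x =
  \sum_(m <- mpoly.msupp P) mpoly.mcoeff m P * \prod_i (y i x : R) ^+ m i :> R.
Proof.
have ev_sum (I : Type) (s : seq I) (g : I -> R -> R^o) :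
    (\sum_(i <- s) g i) x = \sum_(i <- s) g i x.
  by apply: (big_morph (fun h : R -> R^o => h x)).
have ev_prod (I : Type) (s : seq I) (g : I -> R -> R^o) :
    (\prod_(i <- s) g i) x = \prod_(i <- s) g i x.
  by apply: (big_morph (fun h : R -> R^o => h x)).
have ev_exp (g : R -> R^o) n : (g ^+ n) x = g x ^+ n.
  by elim: n => [|n IHn] //; rewrite !exprS -IHn.
rewrite /poly_eval /mpoly.mmap ev_sum; apply: eq_bigr => m _.
rewrite -[LHS]/((mpoly.mcoeff m P * 1) * (mpoly.mmap1 y m) x) mulr1.
rewrite /mpoly.mmap1 ev_prod; congr (_ * _).
by apply: eq_bigr => i _; rewrite ev_exp.
Qed.

(** Substituting exp (r i * t) for the i-th variable turns the monomial m into
    exp (b * t), with b the combination of the r i weighted by m. *)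
Definition exp_terms {R : realType} {k : nat} (r : 'I_k -> R)
    (P : mpoly.mpoly k R) : seq (R * R) :=
  [seq (mpoly.mcoeff m P, \sum_i (m i)%:R * r i) | m <- mpoly.msupp P].

Lemma poly_eval_expR {R : realType} {k : nat} (r : 'I_k -> R)
    (P : mpoly.mpoly k R) (f : R -> R) :
  poly_eval (L := (R -> R^o)%type) (fun i x => expR (r i * f x)) P =
  expsum (exp_terms r P) \o f.
Proof.
apply/funext => x; rewrite poly_eval_funE /= /expsum [RHS]big_map.
apply: eq_bigr => m _ /=; congr (_ * _).
rewrite mulr_suml expR_sum; apply: eq_bigr => i _.
by rewrite -expRM_natl mulrA.
Qed.

Lemma prefix_exponent_inj {R : realType} {k : nat} {a : 'I_k -> nat -> bool} :
  injective a ->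
  injective (fun m : mpoly.multinom k => \sum_i (m i)%:R * prefix_real R (a i)).
Proof.
move=> inj_a m m' mm'; apply/mpoly.mnmP => i.
have := @prefix_real_free R k a (fun i => (m i)%:Z - (m' i)%:Z) inj_a _ i.
move=> H; apply/eqP; rewrite -eqz_nat -subr_eq0; apply/eqP; apply: H.
under eq_bigr do rewrite rmorphB mulrBl /=.
by rewrite sumrB mm' subrr.
Qed.

(** Nonzero exponents are what makes every coefficient of the derivative nonzero;
    a constant term would be lost there. *)
Lemma strong_SZ_expsum {R : realType} {s : seq (R * R)} {f : R -> R} :
  s != [::] -> uniq (map snd s) -> all (fun p => (p.1 != 0) && (p.2 != 0)) s ->
  strong_SZ R f -> strong_SZ R (expsum s \o f).
Proof.
move=> s0 us sn0.
have : countable [set t | expsum (expsum_deriv s) t = 0].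
  apply: countable_expsum_zeros.
  - by rewrite -size_eq0 size_map size_eq0.
  - by rewrite -map_comp.
  - rewrite all_map; apply: sub_all sn0 => p /andP[p1 p2] /=.
    by rewrite mulf_neq0.
move=> /(countable_monotone_cover (is_derive_expsum s) (continuous_expsum _)).
by move=> [C [cC covC mC]]; exact: (strong_SZ_comp_countable_monotone cC covC mC).
Qed.

Theorem theorem2p7 (R : realType) :
  strong_SZ R !=set0 ->
  strongly_algebrable (L := (R -> R^o)%type) [set: nat -> bool] (strong_SZ R).
Proof.
move=> [f szf].
pose Y (a : nat -> bool) : R -> R^o := fun x => expR (prefix_real R a * f x).
exists (range Y); split.
  apply: inj_card_eq => a b _ _ Yab; apply: contrapT => neq_ab.
  apply: (strong_SZ_neq_cst f 0 szf); apply/funext => x.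
  have /expR_inj/eqP := congr1 (fun h => h x) Yab.
  rewrite -subr_eq0 -mulrBl mulf_eq0 subr_eq0 => /orP[/eqP rab|/eqP //].
  by have := neq_ab (prefix_real_inj R a b rab).
move=> k P y _ P0 P00 inj_y Yy.
have /choice[a aE] i : exists a, Y a = y i by have [a _ <-] := Yy i; exists a.
have inj_a : injective a by move=> i j aij; apply: inj_y; rewrite -!aE aij.
have -> : y = fun i x => expR (prefix_real R (a i) * f x).
  by apply/funext => i; rewrite -aE.
rewrite poly_eval_expR; set s := exp_terms _ P.
suff szP : strong_SZ R (expsum s \o f).
  by split=> //; apply/eqP; exact: strong_SZ_neq_cst szP.
have exp_inj := prefix_exponent_inj (R := R) inj_a.
apply: strong_SZ_expsum szf.
- by rewrite -size_eq0 size_map size_eq0 mpoly.msupp_eq0.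
- by rewrite -map_comp map_inj_uniq// mpoly.msupp_uniq.
- rewrite all_map; apply/allP => m; rewrite mpoly.mcoeff_msupp /= => mP.
  rewrite mP /=; apply: contra_neq mP => m0.
  rewrite -P00; congr (mpoly.mcoeff _ P); apply: exp_inj => /=.
  by rewrite m0 big1// => i _; rewrite mpoly.mnm0E mul0r.
Qed.
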